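(* Let $d\geq 2$ and let $\Gamma=F_d$ be the free group of rank $d$. Then there exists a chain $(\Gamma_n)_{n\ge 0}$ in $\Gamma$ such that $\bigcap_{n}\Gamma_n=1$ and the boundary representation of $\Gamma$ with respect to the chain $(\Gamma_n)$ is not essentially free.
   Context: A chain in a group $\Gamma$ is a sequence $\Gamma=\Gamma_0\geq\Gamma_1\geq\Gamma_2\geq\cdots$ of subgroups of finite index in $\Gamma$ (not necessarily normal). The coset tree $T=T(\Gamma,(\Gamma_n))$ has as vertices the right cosets $\Gamma_n g$ ($n\ge 0$, $g\in\Gamma$), where the cosets of $\Gamma_n$ form level $n$; there is an edge between $\Gamma_n g$ and $\Gamma_{n+1}h$ exactly when $\Gamma_n g\supseteq\Gamma_{n+1}h$. It is a tree rooted at the vertex $\Gamma=\Gamma_0$, and $\Gamma$ acts on it by automorphisms via right multiplication on cosets. The boundary $\partial T$ is the set of infinite rays starting from the root. For a vertex $t=\Gamma_n g$ its shadow is $\mathrm{Sh}(t)=\{x\in\partial T\mid t\in x\}$. The shadows form a base of the topology on $\partial T$, and $\mu$ is the Borel probability measure on $\partial T$ with $\mu(\mathrm{Sh}(\Gamma_n g))=1/|\Gamma:\Gamma_n|$. The induced action of $\Gamma$ on $\partial T$ by measure-preserving homeomorphisms is called the boundary representation of $\Gamma$ with respect to $(\Gamma_n)$. It is essentially free if $\mu$-almost every $x\in\partial T$ has trivial stabilizer in $\Gamma$. *)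

(* Defs.v *)
From HB Require Import structures.
From mathcomp Require Import all_boot all_order all_algebra finmap.
Import Order.TTheory GRing.Theory Num.Theory.
From mathcomp Require Import all_classical all_reals all_analysis.

Set Implicit Arguments.
Unset Strict Implicit.
Unset Printing Implicit Defensive.

Local Open Scope classical_set_scope.
Local Open Scope group_scope.

(* The letter [(i, false)] is the [i]-th generator and [(i, true)] is its
   formal inverse. *)
Definition letter (d : nat) : Type := ('I_d * bool)%type.

Definition letter_inv d (a : letter d) : letter d := (a.1, ~~ a.2).

Definition reduced d (w : seq (letter d)) : bool :=
  sorted (fun a b : letter d => b != letter_inv a) w.

Record free_group (d : nat) := FreeGroup {
  word :> seq (letter d);
  word_reduced : reduced word }.

HB.instance Definition _ d := [isSub for @word d].
HB.instance Definition _ d := [Choice of free_group d by <:].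

Section FreeGroup.
Variable d : nat.
Implicit Types (a b : letter d) (u v w : seq (letter d)).

Definition push a w : seq (letter d) :=
  if w is b :: w' then if b == letter_inv a then w' else a :: w else [:: a].

Lemma letter_invK : involutive (@letter_inv d).
Proof. by case=> i e; rewrite /letter_inv /= negbK. Qed.

Lemma reduced_behead a w : reduced (a :: w) -> reduced w.
Proof. by case: w => //= b w /andP[]. Qed.

Lemma reduced_push a w : reduced w -> reduced (push a w).
Proof.
case: w => //= b w; case: eqVneq => [_ | ba] rw; last by rewrite /= ba.
exact: (@reduced_behead b).
Qed.

Lemma pushK a w : reduced w -> push (letter_inv a) (push a w) = w.
Proof.
case: w => [|b w] /=; first by rewrite letter_invK eqxx.
case: eqVneq => [-> | ba] rw /=; last by rewrite letter_invK eqxx.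
by case: w rw => //= c w /andP[/negPf-> _].
Qed.

Lemma reduced_foldr u w : reduced w -> reduced (foldr push w u).
Proof. by elim: u => //= a u IHu /IHu; exact: reduced_push. Qed.

Lemma foldr_push_reduced u : reduced u -> foldr push [::] u = u.
Proof.
elim: u => //= a u IHu ru; rewrite IHu ?(reduced_behead ru)//.
by case: u ru {IHu} => //= b u /andP[/negPf-> _].
Qed.

Lemma foldr_push_cons a u w :
  reduced w -> foldr push w (push a u) = push a (foldr push w u).
Proof.
case: u => //= b u rw; case: eqVneq => [-> | //].
by have := pushK (letter_inv a) (reduced_foldr u rw); rewrite letter_invK.
Qed.

Lemma foldr_pushA u v w :
  reduced w -> foldr push w (foldr push v u) = foldr push (foldr push w v) u.
Proof. by move=> rw; elim: u => //= a u IHu; rewrite foldr_push_cons// IHu. Qed.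

Definition word_inv w : seq (letter d) := rev (map (@letter_inv d) w).

Lemma reduced_inv w : reduced w -> reduced (word_inv w).
Proof.
rewrite /reduced /word_inv rev_sorted sorted_map; apply: sub_sorted => a b /=.
by apply: contraNneq => ->; rewrite !letter_invK.
Qed.

Lemma word_invK : involutive word_inv.
Proof.
by move=> w; rewrite /word_inv map_rev revK -map_comp map_id_in// => a _ /=;
  rewrite letter_invK.
Qed.

Lemma foldr_push_inv u w : reduced w -> foldr push (foldr push w u) (word_inv u) = w.
Proof.
elim: u w => [|a u IHu] w rw //=.
rewrite /word_inv /= rev_cons -cats1 foldr_cat /= pushK ?reduced_foldr//.
exact: IHu.
Qed.

Definition free_one : free_group d := @FreeGroup d [::] isT.

Definition free_mul (u v : free_group d) : free_group d :=
  FreeGroup (reduced_foldr u (word_reduced v)).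

Definition free_inv (u : free_group d) : free_group d :=
  FreeGroup (reduced_inv (word_reduced u)).

Lemma free_mulA : associative free_mul.
Proof.
by move=> u v w; apply: val_inj; rewrite /= foldr_pushA// word_reduced.
Qed.

Lemma free_mul1 : left_id free_one free_mul.
Proof. by move=> u; apply: val_inj. Qed.

Lemma free_mulr1 : right_id free_one free_mul.
Proof. by move=> u; apply: val_inj; rewrite /= foldr_push_reduced ?word_reduced. Qed.

Lemma free_mulV : left_inverse free_one free_inv free_mul.
Proof.
move=> u; apply: val_inj => /=.
by rewrite -[X in foldr _ X _]foldr_push_reduced ?word_reduced// foldr_push_inv.
Qed.

Lemma free_invK : involutive free_inv.
Proof. by move=> u; apply: val_inj; rewrite /= word_invK. Qed.

Lemma free_mulrV : right_inverse free_one free_inv free_mul.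
Proof. by move=> u; rewrite -{1}[u]free_invK free_mulV. Qed.

HB.instance Definition _ := isGroup.Build (free_group d)
  free_mulA free_mul1 free_mulr1 free_mulV free_mulrV.

Definition free_gen (i : 'I_d) : free_group d := @FreeGroup d [:: (i, false)] isT.

End FreeGroup.

(* The universal property: [free_gen] is a basis of [free_group d]. *)
Section FreeGroupUniversal.
Variables (d : nat) (G : groupType) (f : 'I_d -> G).

Definition free_eval_letter (a : letter d) : G := if a.2 then (f a.1)^-1 else f a.1.

Definition free_eval (w : free_group d) : G :=
  foldr (fun a x => free_eval_letter a * x) 1 w.

Lemma free_eval_gen i : free_eval (free_gen i) = f i.
Proof. by rewrite /free_eval /= mulg1. Qed.

Lemma free_evalM : {morph free_eval : u v / u * v}.
Proof.
have evalV a : free_eval_letter (letter_inv a) = (free_eval_letter a)^-1.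
  by case: a => i [] //=; rewrite /free_eval_letter /= ?invgK.
move=> u v; rewrite /free_eval /=.
elim: (u : seq _) => [|a w IHw] /=; first by rewrite mul1g.
rewrite -mulgA -IHw; case: (foldr _ _ w) => //= b w'.
by case: eqP => [->|//]; rewrite evalV mulVKg.
Qed.

Lemma free_eval_unique (h : free_group d -> G) :
  {morph h : u v / u * v} -> (forall i, h (free_gen i) = f i) -> h =1 free_eval.
Proof.
move=> hM hgen; have h1 : h 1 = 1 by apply: (@mulgI _ (h 1)); rewrite -hM !mulg1.
have hV u : h u^-1 = (h u)^-1.
  by apply: (@mulgI _ (h u)); rewrite -hM !mulgV.
have hl i e : h (@FreeGroup d [:: (i, e)] isT) = free_eval_letter (i, e).
  case: e; rewrite /free_eval_letter /= -hgen// -hV; congr h; exact: val_inj.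
case=> w; rewrite /free_eval /=; elim: w => [|[i e] w IHw] rw /=.
  by rewrite -[RHS]h1; congr h; exact: val_inj.
rewrite -(IHw (reduced_behead rw)) -hl -hM; congr h; apply: val_inj => /=.
by case: w rw {IHw} => //= b w /andP[/negPf->].
Qed.

End FreeGroupUniversal.

Section Chains.
Variable G : groupType.

Definition right_coset (H : set G) (g : G) : set G := [set h * g | h in H].

Definition right_cosets (H : set G) : set (set G) := range (right_coset H).

Definition subgroup_index (H : set G) : nat := #|` fset_set (right_cosets H)|.

Record chain := Chain {
  chain_set :> nat -> set G;
  chain_group : forall n, group_closed [in chain_set n];
  chain_finite_index : forall n, finite_set (right_cosets (chain_set n));
  chain_0 : chain_set 0 = setT;
  chain_S : forall n, chain_set n.+1 `<=` chain_set n }.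

End Chains.

Section CosetTree.
Variables (G : groupType) (c : chain G).

(* A vertex carries its level, since a coset of [c n] may also be a coset of
   [c n.+1]. *)
Definition vertices : set (nat * set G) := [set t | right_cosets (c t.1) t.2].

Definition child_of (t u : nat * set G) : Prop :=
  t.1 = u.1.+1 /\ t.2 `<=` u.2.

Definition tree_adjacent (t u : nat * set G) : Prop := child_of t u \/ child_of u t.

Definition tree_root : nat * set G := (0, [set: G]).

(* Rays are one-way infinite simple paths in the undirected tree. *)
Record ray := Ray {
  ray_vertex :> nat -> nat * set G;
  ray_root : ray_vertex 0 = tree_root;
  ray_vertices : forall k, vertices (ray_vertex k);
  ray_adjacent : forall k, tree_adjacent (ray_vertex k) (ray_vertex k.+1);
  ray_inj : injective ray_vertex }.

Definition shadow (t : nat * set G) : set ray := [set x | exists k, x k = t].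

Lemma ray_ext (x y : ray) : (forall k, x k = y k) -> x = y.
Proof.
case: x y => [x x0 xv xa xi] [y y0 yv ya yi] /= /funext exy.
by rewrite -exy in y0 yv ya yi *; congr Ray; exact: Prop_irrelevance.
Qed.

Lemma chain1 n : c n 1.
Proof. by have [+ _] := chain_group c n; rewrite inE. Qed.

Lemma chainF n g h : c n g -> c n h -> c n (g / h).
Proof.
have [_ cF] := chain_group c n; move=> cg ch.
by have := cF g h; rewrite !inE => /(_ cg ch).
Qed.

Lemma chainV n g : c n g -> c n g^-1.
Proof. by move=> cg; rewrite -div1g; apply: chainF => //; exact: chain1. Qed.

Lemma chainM n g h : c n g -> c n h -> c n (g * h).
Proof. by move=> cg /chainV ch; rewrite -[h]invgK; exact: chainF. Qed.

Lemma right_cosetP n g h : right_coset (c n) g h <-> c n (h / g).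
Proof.
split=> [[k ck <-]|ch]; first by rewrite mulgK.
by exists (h / g) => //; rewrite mulgVK.
Qed.

Lemma right_coset_refl n g : right_coset (c n) g g.
Proof. by apply/right_cosetP; rewrite mulgV; exact: chain1. Qed.

Lemma right_coset_eq n g h : c n (h / g) -> right_coset (c n) h = right_coset (c n) g.
Proof.
move=> cgh; apply/seteqP; split=> k /right_cosetP ck; apply/right_cosetP.
  by have := chainM ck cgh; rewrite -mulgA mulKg.
by have := chainM ck (chainV cgh); rewrite invgM invgK -mulgA mulKg.
Qed.

Lemma right_coset_S n g : right_coset (c n.+1) g `<=` right_coset (c n) g.
Proof. by move=> h /right_cosetP/chain_S ch; apply/right_cosetP. Qed.

Lemma right_coset_meet n A B g :
  right_cosets (c n) A -> right_cosets (c n) B -> A g -> B g -> A = B.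
Proof.
by move=> [a _ <-] [b _ <-] /right_cosetP/right_coset_eq <- /right_cosetP/right_coset_eq.
Qed.

Lemma right_cosetsE n A g : right_cosets (c n) A -> A g -> A = right_coset (c n) g.
Proof. by move=> cA Ag; apply: (right_coset_meet cA) Ag (right_coset_refl n g); exists g. Qed.

Lemma right_cosets_neq0 n A : right_cosets (c n) A -> A !=set0.
Proof. by case=> a _ <-; exists a; exact: right_coset_refl. Qed.

Lemma ray_level (x : ray) k : (x k).1 = k.
Proof.
elim/ltn_ind: k => -[|k] IHk; first by rewrite ray_root.
have [] := ray_adjacent x k; last by case=> -> _; rewrite IHk.
case: k IHk => [|k] IHk [lk xk]; first by rewrite ray_root in lk.
have [] := ray_adjacent x k; first by case=> + _; rewrite (IHk k)// (IHk k.+1)// => /eqP; rewrite ltn_eqF.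
case=> _ xk'; move: lk; rewrite (IHk k.+1)// => -[lk].
have [g xg] := right_cosets_neq0 (ray_vertices x k.+1).
have : x k = x k.+2.
  have := ray_vertices x k; have := ray_vertices x k.+2; rewrite /vertices /=.
  move: lk (IHk k (leqnSn _)) (xk g xg) (xk' g xg).
  case: (x k) (x k.+2) => [m A] [m' B] /= -> -> Bg Ag cB cA; congr pair.
  exact: right_coset_meet cA cB Ag Bg.
by move=> /ray_inj/eqP; rewrite -[X in X == _]addn0 -[k.+2]addn2 eqn_add2l.
Qed.

Lemma ray_coset (x : ray) k : right_cosets (c k) (x k).2.
Proof. by have := ray_vertices x k; rewrite /vertices /= ray_level. Qed.

Lemma ray_pairE (x : ray) k : x k = (k, (x k).2).
Proof. by rewrite -{2}(ray_level x k); case: (x k). Qed.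

Lemma ray_S (x : ray) k : (x k.+1).2 `<=` (x k).2.
Proof.
have [[]|[]//] := ray_adjacent x k.
by rewrite !ray_level => /eqP; rewrite ltn_eqF// -addn2 -[X in (X < _)%N]addn0 ltn_add2l.
Qed.

Lemma ray_le (x : ray) j k : (j <= k)%N -> (x k).2 `<=` (x j).2.
Proof.
elim: k => [|k IHk]; first by rewrite leqn0 => /eqP ->.
rewrite leq_eqVlt => /predU1P[-> //|/IHk]; apply: subset_trans; exact: ray_S.
Qed.

Lemma ray_agree (x y : ray) j k : (j <= k)%N -> (x k).2 = (y k).2 -> x j = y j.
Proof.
move=> jk xy; rewrite ray_pairE [RHS]ray_pairE; congr pair.
have [g xg] := right_cosets_neq0 (ray_coset x k).
apply: (right_coset_meet (ray_coset x j) (ray_coset y j) (ray_le jk xg)).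
by rewrite xy in xg; exact: ray_le jk _ xg.
Qed.

Lemma shadowP (x : ray) t : shadow t x <-> x t.1 = t.
Proof. by split=> [[k <-]|xt]; [rewrite ray_level | exists t.1]. Qed.

Section RayOfSeq.
Variable A : nat -> set G.
Hypotheses (AT : A 0 = setT) (cA : forall k, right_cosets (c k) (A k))
  (AS : forall k, A k.+1 `<=` A k).

Definition ray_of_seq : ray.
Proof.
apply: (@Ray (fun k => (k, A k))).
- by rewrite AT.
- by move=> k; exact: cA.
- by move=> k; right; split => //; exact: AS.
- by move=> j k [].
Defined.

End RayOfSeq.

Lemma ray_through_subproof g :
  [/\ right_coset (c 0) g = setT,
      forall k, right_cosets (c k) (right_coset (c k) g) &
      forall k, right_coset (c k.+1) g `<=` right_coset (c k) g].
Proof.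
split=> [|k|k]; [|by exists g|exact: right_coset_S].
by apply/seteqP; split=> // h _; apply/right_cosetP; rewrite chain_0.
Qed.

(* The ray of the cosets containing [g]. *)
Definition ray_through (g : G) : ray :=
  let: And3 h0 h1 h2 := ray_through_subproof g in ray_of_seq h0 h1 h2.

Lemma ray_throughE g k : ray_through g k = (k, right_coset (c k) g).
Proof. by rewrite /ray_through; case: ray_through_subproof. Qed.

HB.instance Definition _ := gen_eqMixin ray.
HB.instance Definition _ := gen_choiceMixin ray.
HB.instance Definition _ := isPointed.Build ray (ray_through 1).

Lemma shadow_cover : \bigcup_(t in vertices) shadow t = setT.
Proof.
by apply/seteqP; split=> // x _; exists (x 0); [exact: ray_vertices|exists 0].
Qed.

Lemma shadow_join t u x : vertices t -> vertices u -> shadow t x -> shadow u x ->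
  exists v, [/\ vertices v, shadow v x & shadow v `<=` shadow t `&` shadow u].
Proof.
move=> _ _ /shadowP xt /shadowP xu; pose m := maxn t.1 u.1.
exists (x m); split; [exact: ray_vertices|by exists m|].
move=> y /shadowP; rewrite ray_level => /(congr1 snd) yx.
split; apply/shadowP.
  by rewrite -[RHS]xt; apply: ray_agree yx; exact: leq_maxl.
by rewrite -[RHS]xu; apply: ray_agree yx; exact: leq_maxr.
Qed.

HB.instance Definition _ := isBaseTopological.Build ray shadow_cover shadow_join.

Definition boundary : measurableType _ := g_sigma_algebraType (@open ray).

End CosetTree.

(* Existence of the boundary measure, by Carathéodory extension from the
   algebra of sets of rays that are determined by a finite level. *)
Section CylinderAlgebra.
Variables (G : groupType) (c : chain G).
Implicit Types (n : nat) (A : set (ray c)) (v w : set G).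

Definition cylinder n A : Prop :=
  forall x y : ray c, (x n).2 = (y n).2 -> A x -> A y.

Definition trace n A : set (set G) := [set (x n).2 | x in A].

Definition children n v : set (set G) :=
  [set w | right_cosets (c n.+1) w /\ w `<=` v].

Lemma cylinder_le m n A : (m <= n)%N -> cylinder m A -> cylinder n A.
Proof. by move=> mn cA x y xy; apply: cA; rewrite (ray_agree mn xy). Qed.

Lemma cylinderU m n A B : cylinder m A -> cylinder n B -> cylinder (maxn m n) (A `|` B).
Proof.
move=> /(cylinder_le (leq_maxl m n)) cA /(cylinder_le (leq_maxr m n)) cB x y xy.
by case=> [/(cA _ _ xy)|/(cB _ _ xy)]; [left|right].
Qed.

Lemma cylinderC n A : cylinder n A -> cylinder n (~` A).
Proof. by move=> cA x y xy nAx /(cA _ _ (esym xy)). Qed.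

Lemma cylinder_shadow t : cylinder t.1 (shadow (c := c) t).
Proof.
move=> x y xy /shadowP xt; apply/shadowP.
by rewrite -[RHS]xt; apply: esym; exact: ray_agree (leqnn _) xy.
Qed.

Lemma trace_coset n A v : trace n A v -> right_cosets (c n) v.
Proof. by case=> x _ <-; exact: ray_coset. Qed.

Lemma finite_trace n A : finite_set (trace n A).
Proof.
by apply: sub_finite_set (chain_finite_index c n) => v; exact: trace_coset.
Qed.

Lemma finite_children n v : finite_set (children n v).
Proof. by apply: sub_finite_set (chain_finite_index c n.+1) => w []. Qed.

Lemma mem_trace n A (x : ray c) : cylinder n A -> trace n A (x n).2 -> A x.
Proof. by move=> cA [y Ay yx]; exact: cA yx Ay. Qed.

Lemma traceU n A B : trace n (A `|` B) = trace n A `|` trace n B.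
Proof. exact: image_setU. Qed.

Lemma traceI n A B : cylinder n A -> cylinder n B ->
  trace n (A `&` B) = trace n A `&` trace n B.
Proof.
move=> cA cB; apply/seteqP; split=> [_ [x [Ax Bx] <-]|_ [[x Ax <-]]].
  by split; exists x.
by move=> /(mem_trace cB) Bx; exists x.
Qed.

Lemma right_cosets_ray n v : right_cosets (c n) v -> exists x : ray c, (x n).2 = v.
Proof. by case=> g _ <-; exists (ray_through c g); rewrite ray_throughE. Qed.

Lemma traceT n : trace n [set: ray c] = right_cosets (c n).
Proof.
apply/seteqP; split=> v; first exact: trace_coset.
by case/right_cosets_ray=> x <-; exists x.
Qed.

Lemma card_children n v : right_cosets (c n) v ->
  #|` fset_set (children n v)| = #|` fset_set (children n (c n))|.
Proof.
have tr m g h : [set x * g | x in right_coset (c m) h] = right_coset (c m) (h * g).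
  apply/seteqP; split=> [_ [_ [k ck <-] <-]|_ [k ck <-]].
    by exists k => //; rewrite mulgA.
  by exists (k * h); [exists k|rewrite mulgA].
have trK (g : G) : cancel (fun w => [set x * g | x in w]) (fun w => [set x * g^-1 | x in w]).
  move=> w; rewrite image_comp (_ : _ \o _ = id) ?image_id//.
  by apply/funext => x /=; rewrite mulgK.
have c1 : c n = right_coset (c n) 1.
  by apply/seteqP; split=> g; [rewrite -{1}[g]divg1|rewrite -{2}[g]divg1] => /right_cosetP.
case=> g _ <-; set tg := fun w : set G => [set x * g | x in w].
have -> : children n (right_coset (c n) g) = tg @` children n (c n).
  apply/seteqP; split=> [w [[h _ <-] hg]|_ [w [[h _ <-] hc] <-]].
    exists (right_coset (c n.+1) (h * g^-1)); last by rewrite /tg tr mulgVK.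
    split; first by exists (h * g^-1).
    rewrite -tr => _ [x /hg/right_cosetP cx <-]; exact: cx.
  split; first by rewrite /tg tr; exists (h * g).
  have -> : right_coset (c n) g = tg (c n) by rewrite /tg {2}c1 tr mul1g.
  exact: image_subset.
rewrite fset_set_image; last exact: finite_children.
by rewrite card_imfset//=; exact: can_inj (trK g).
Qed.

Lemma card_trace_S n A : cylinder n A ->
  #|` fset_set (trace n.+1 A)| =
  (#|` fset_set (children n (c n))| * #|` fset_set (trace n A)|)%N.
Proof.
move=> cA; pose up w := \bigcup_(g in w) right_coset (c n) g.
have upE (x : ray c) : up (x n.+1).2 = (x n).2.
  have [g xg] := right_cosets_neq0 (ray_coset x n.+1).
  apply/seteqP; split=> [h [k /ray_S xk]|h xh].
    by rewrite -(right_cosetsE (ray_coset x n) xk).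
  by exists g => //; rewrite -(right_cosetsE (ray_coset x n) (ray_S xg)).
rewrite card_fset_sum1 (partition_big_imfset _ up) /=.
have -> : (up @` fset_set (trace n.+1 A))%fset = fset_set (trace n A).
  rewrite -fset_set_image; last exact: finite_trace.
  congr fset_set; rewrite /trace image_comp; apply: eq_imagel => x _ /=; exact: upE.
rewrite [RHS]mulnC card_fset_sum1 big_distrl /=.
rewrite big_seq_cond [RHS]big_seq_cond; apply: eq_bigr => v.
rewrite andbT in_fset_set ?inE; last exact: finite_trace.
case=> x Ax <-; rewrite big_fset_condE /= mul1n -card_fset_sum1.
rewrite -(card_children (ray_coset x n)); congr #|` _|; apply/fsetP => w.
rewrite !inE /= !in_fset_set; [|exact: finite_children|exact: finite_trace].
apply/andP/idP; rewrite !inE.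
  case=> -[y _ <-]; rewrite upE => <-; split; [exact: ray_coset|exact: ray_S].
case=> /right_cosets_ray[y <-] yx.
have {}yx : (y n).2 = (x n).2.
  have [g yg] := right_cosets_neq0 (ray_coset y n.+1).
  exact: right_coset_meet (ray_coset y n) (ray_coset x n) (ray_S yg) (yx g yg).
by split; [exists y => //; exact: cA (esym yx) Ax|rewrite upE yx].
Qed.

Lemma subgroup_index_gt0 n : (0 < subgroup_index (c n))%N.
Proof.
rewrite cardfs_gt0; apply/fset0Pn; exists (right_coset (c n) 1).
by rewrite in_fset_set ?inE; [exists 1|exact: chain_finite_index].
Qed.

Section Compactness.
Variables (D : set (ray c)) (F : nat -> set (ray c)).
Hypotheses (cD : exists n, cylinder n D) (cF : forall i, exists n, cylinder n (F i)).
Hypothesis DF : D `<=` \bigcup_i F i.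

Let bad n v := forall N, exists x : ray c,
  [/\ D x, (x n).2 = v & forall i, (i < N)%N -> ~ F i x].

Let bad_child n v : bad n v -> exists w, children n v w /\ bad n.+1 w.
Proof.
move=> bv; apply: contrapT => nb.
have /choice[N hN] : forall w, exists N, children n v w ->
    forall x : ray c, D x -> (x n.+1).2 = w -> exists2 i, (i < N)%N & F i x.
  move=> w; have [cw|ncw] := pselect (children n v w); last by exists 0.
  apply: contrapT => hw; apply: nb; exists w; split=> // N.
  apply: contrapT => hx; apply: hw; exists N => _ x Dx xw.
  apply: contrapT => hF; apply: hx; exists x; split=> // i iN Fx.
  by apply: hF; exists i.
have [x [Dx xv hx]] := bv (\max_(w <- fset_set (children n v)) N w)%N.
have cx : children n v (x n.+1).2.
  by split; [exact: ray_coset|rewrite -xv; exact: ray_S].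
have [i iN Fx] := hN _ cx _ Dx erefl; apply: hx Fx; apply: leq_trans iN _.
by apply: leq_bigmax_seq => //; rewrite in_fset_set ?inE//; exact: finite_children.
Qed.

Lemma cylinder_compact : exists N, forall x, D x -> exists2 i, (i < N)%N & F i x.
Proof.
apply: contrapT => nfin.
have bad0 : bad 0 setT.
  move=> N; apply: contrapT => hx; apply: nfin; exists N => x Dx.
  apply: contrapT => hF; apply: hx; exists x; split=> //; first by rewrite ray_root.
  by move=> i iN Fx; apply: hF; exists i.
pose A := fix A n : set G :=
  if n is k.+1 then xget set0 [set w | children k (A k) w /\ bad k.+1 w] else setT.
have badA n : bad n (A n).
  elim: n => // n IHn; have [w bw] := bad_child IHn.
  by have /= [] := xgetPex set0 (ex_intro _ w bw : [set w | _] !=set0).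
have childA n : children n (A n) (A n.+1).
  have [w bw] := bad_child (badA n).
  by have /= [] := xgetPex set0 (ex_intro _ w bw : [set w | _] !=set0).
have cA n : right_cosets (c n) (A n).
  case: n => [|n]; last by have [] := childA n.
  by exists 1 => //=; have [-> _ _] := ray_through_subproof c 1.
pose x := ray_of_seq (erefl : A 0 = setT) cA (fun k => (childA k).2).
have Dx : D x.
  have [n cDn] := cD; have [y [Dy yA _]] := badA n 0.
  exact: cDn Dy.
have [i _ Fx] := DF Dx; have [n cFn] := cF i.
by have [y [_ yA /(_ i (ltnSn i))]] := badA n i.+1; apply; exact: cFn Fx.
Qed.

End Compactness.

Definition cylinder_space : Type := ray c.

HB.instance Definition _ := Pointed.on cylinder_space.

Definition cylinders : set (set cylinder_space) := [set A | exists n, cylinder n A].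

Lemma cylinders0 : cylinders set0.
Proof. by exists 0. Qed.

Lemma cylindersU : setU_closed cylinders.
Proof. by move=> A B [m cA] [n cB]; exists (maxn m n); exact: cylinderU. Qed.

Lemma cylindersC : setC_closed cylinders.
Proof. by move=> A [m cA]; exists m; exact: cylinderC. Qed.

HB.instance Definition _ := @isAlgebraOfSets.Build default_measure_display
  cylinder_space cylinders cylinders0 cylindersU cylindersC.

End CylinderAlgebra.

Arguments cylinders {G} c _.

Section BoundaryMeasure.
Local Open Scope ring_scope.
Local Open Scope ereal_scope.
Variables (R : realType) (G : groupType) (c : chain G).
Implicit Types A : set (cylinder_space c).

(* The proportion of level [n] vertices that lie on a ray in [A]. *)
Definition level_ratio n A : \bar R :=
  (#|` fset_set (trace n A)|%:R / (subgroup_index (c n))%:R)%:E.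

Lemma level_ratio_S n A : cylinder n A -> level_ratio n.+1 A = level_ratio n A.
Proof.
move=> cA; rewrite /level_ratio /subgroup_index -!traceT.
rewrite (card_trace_S cA) (@card_trace_S _ c n setT)//.
have := subgroup_index_gt0 c n.+1; rewrite /subgroup_index -traceT.
rewrite (@card_trace_S _ c n setT)// muln_gt0 => /andP[k0 i0].
rewrite !natrM -mulf_div divff ?mul1r//.
by rewrite pnatr_eq0 -lt0n.
Qed.

Lemma level_ratio_le m n A : (m <= n)%N -> cylinder m A -> level_ratio n A = level_ratio m A.
Proof.
move=> /subnK <-; elim: (n - m)%N => // k IHk cA.
by rewrite addSn level_ratio_S ?IHk//; apply: cylinder_le cA; exact: leq_addl.
Qed.

Definition cylinder_measure A : \bar R :=
  if pselect (exists n, cylinder n A) is left e then level_ratio (projT1 (cid e)) A else 0.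

Lemma cylinder_measureE n A : cylinder n A -> cylinder_measure A = level_ratio n A.
Proof.
move=> cA; rewrite /cylinder_measure; case: pselect => [e|[]]; last by exists n.
case: cid => m /= cmA.
by rewrite -(level_ratio_le (leq_maxl m n))// -(level_ratio_le (leq_maxr m n)).
Qed.

Lemma level_ratio_ge0 n A : 0 <= level_ratio n A.
Proof. by rewrite lee_fin divr_ge0. Qed.

Lemma cylinder_measure_ge0 A : 0 <= cylinder_measure A.
Proof. by rewrite /cylinder_measure; case: pselect => // e; exact: level_ratio_ge0. Qed.

Lemma cylinder_measure0 : cylinder_measure set0 = 0.
Proof.
rewrite (@cylinder_measureE 0 set0)// /level_ratio /trace image_set0 fset_set0.
by rewrite cardfs0 mul0r.
Qed.

Lemma cylinder_measure_additive : semi_additive cylinder_measure.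
Proof.
apply/(additive2P cylinder_measure0) => A B [m cA] [n cB] AB0.
have {}cA := cylinder_le (leq_maxl m n) cA.
have {}cB := cylinder_le (leq_maxr m n) cB.
rewrite (cylinder_measureE cA) (cylinder_measureE cB).
rewrite (@cylinder_measureE (maxn m n)); last first.
  by rewrite -[maxn m n]maxnn; exact: cylinderU.
rewrite /level_ratio -EFinD -mulrDl -natrD traceU.
rewrite fset_setU; [|exact: finite_trace..].
rewrite cardfsU -fset_setI; [|exact: finite_trace..].
by rewrite -traceI// AB0 /trace image_set0 fset_set0 cardfs0 subn0.
Qed.

HB.instance Definition _ := isContent.Build _ _ _ cylinder_measure
  cylinder_measure_ge0 cylinder_measure_additive.

Lemma cylinder_measure_sigma_additive : semi_sigma_additive cylinder_measure.
Proof.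
move=> F cF tF cUF.
have [N FN] := cylinder_compact cUF cF (@subset_refl _ _).
apply: cvg_near_cst; near=> n.
rewrite big_mkord -measure_semi_additive//; last first.
  by apply: bigsetU_measurable => i _; exact: cF.
congr cylinder_measure; apply/seteqP; split=> x.
  by rewrite -bigcup_mkord => -[i _ Fx]; exists i.
move=> /FN[i iN Fx]; rewrite -bigcup_mkord; exists i => //=.
by apply: leq_trans iN _; near: n; exact: nbhs_infty_ge.
Unshelve. all: by end_near. Qed.

HB.instance Definition _ := Content_isMeasure.Build _ _ _ cylinder_measure
  cylinder_measure_sigma_additive.

Lemma open_cylinders (U : set (ray c)) : open U -> <<s cylinders c >> U.
Proof.
move=> oU.
have -> : U = \bigcup_n [set x : ray c | shadow (x n) `<=` U].
  apply/seteqP; split=> [x Ux|x [n _]]; last by apply; exists n.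
  have [D _ UD] : exists2 D, D `<=` vertices c & \bigcup_(t in D) @shadow _ c t = U := oU.
  move: Ux; rewrite -UD => -[t Dt [n xt]]; exists n => //= y.
  by rewrite xt => yt; exists t.
have mU n : (cylinders c).-sigma.-measurable [set x : ray c | shadow (x n) `<=` U].
  apply: sub_sigma_algebra; exists n => x y /= xy.
  by rewrite (ray_agree (leqnn n) xy).
exact: (@bigcupT_measurable _ (g_sigma_algebraType (cylinders c))).
Qed.

(* The Borel probability measure giving the shadow of a level [n] vertex mass
   [1 / |G : c n|]: see [boundary_measure_shadow], and
   [boundary_measure_unique] for uniqueness. *)
Definition boundary_measure : set (boundary c) -> \bar R :=
  measure_extension cylinder_measure.

Lemma boundary_measurable_cylinders (A : set (boundary c)) :
  measurable A -> <<s cylinders c >> A.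
Proof.
apply: smallest_sub => [|U]; last exact: open_cylinders.
exact: smallest_sigma_algebra.
Qed.

Lemma boundary_measure0 : boundary_measure set0 = 0.
Proof. exact: (@measure0 _ _ _ (measure_extension cylinder_measure)). Qed.

Lemma boundary_measure_ge0 A : 0 <= boundary_measure A.
Proof. exact: (@measure_ge0 _ _ _ (measure_extension cylinder_measure)). Qed.

Lemma boundary_measure_sigma_additive : semi_sigma_additive boundary_measure.
Proof.
move=> F mF tF mUF.
apply: (@measure_semi_sigma_additive _ _ _ (measure_extension cylinder_measure)) => //.
- by move=> i; exact: boundary_measurable_cylinders.
- exact: boundary_measurable_cylinders.
Qed.

HB.instance Definition _ := isMeasure.Build _ _ _ boundary_measure
  boundary_measure0 boundary_measure_ge0 boundary_measure_sigma_additive.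

Lemma boundary_measureE n (A : set (ray c)) :
  cylinder n A -> boundary_measure A = level_ratio n A.
Proof.
move=> cA; rewrite -(cylinder_measureE cA).
by apply: measurable_mu_extE; exists n.
Qed.

Lemma boundary_measureT : boundary_measure setT = 1.
Proof.
rewrite (@boundary_measureE 0 setT)// /level_ratio traceT divff//.
by rewrite pnatr_eq0 -lt0n; exact: subgroup_index_gt0.
Qed.

HB.instance Definition _ := Measure_isProbability.Build _ _ _ boundary_measure
  boundary_measureT.

Lemma boundary_measure_shadow t : vertices c t ->
  boundary_measure (shadow t) = ((subgroup_index (c t.1))%:R^-1)%:E.
Proof.
move=> vt; rewrite (boundary_measureE (@cylinder_shadow _ c t)) /level_ratio.
rewrite (_ : trace _ _ = [set t.2]) ?fset_set1 ?cardfs1 ?mul1r//.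
apply/seteqP; split=> [_ [x /shadowP xt <-]|_ ->]; first by rewrite xt.
have [x xt] := right_cosets_ray vt; exists x => //; exists t.1.
by rewrite ray_pairE xt; case: (t).
Qed.

End BoundaryMeasure.

Section BoundaryMeasureUnique.
Local Open Scope ring_scope.
Local Open Scope ereal_scope.
Variables (R : realType) (G : groupType) (c : chain G).

Lemma open_shadow t : vertices c t -> open (shadow t : set (ray c)).
Proof.
move=> vt; suff : exists2 D, D `<=` vertices c & \bigcup_(u in D) @shadow _ c u = shadow t.
  exact.
by exists [set t]; [move=> _ ->|rewrite bigcup_set1].
Qed.

Lemma measurable_shadow t : vertices c t -> measurable (shadow t : set (boundary c)).
Proof. by move=> /open_shadow ot; exact: sub_sigma_algebra. Qed.

Lemma cylinder_shadows n (A : set (ray c)) : cylinder n A ->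
  A = \bigcup_(v in trace n A) shadow (n, v).
Proof.
move=> cA; apply/seteqP; split=> [x Ax|x [v [y Ay <-]] /shadowP/= xy].
  by exists (x n).2; [exists x|exists n; exact: ray_pairE].
by apply: (cA y x) => //; rewrite xy.
Qed.

Lemma trivIset_shadow n (D : set (set G)) :
  trivIset D (fun v => shadow (n, v) : set (ray c)).
Proof.
by move=> v w _ _ [x [/shadowP/= xv /shadowP/=]]; rewrite xv => -[].
Qed.

Lemma boundary_measure_unique (mu : {measure set (boundary c) -> \bar R}) :
  (forall t, vertices c t -> mu (shadow t) = ((subgroup_index (c t.1))%:R^-1)%:E) ->
  forall A, measurable A -> mu A = boundary_measure R A.
Proof.
move=> muS A mA; apply/esym.
have mtrace n (B : set (ray c)) v : trace n B v ->
    measurable (shadow (n, v) : set (boundary c)).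
  by move=> /trace_coset nv; exact: measurable_shadow.
apply: (@measure_unique _ R (boundary c) (cylinders c) (fun=> setT)) => //.
- apply/seteqP; split; first exact: boundary_measurable_cylinders.
  apply: smallest_sub => [|B [n cB]]; first exact: smallest_sigma_algebra.
  rewrite (cylinder_shadows cB); apply: fin_bigcup_measurable.
    exact: finite_trace.
  by move=> v; exact: mtrace.
- move=> B C [m cB] [n cC]; exists (maxn m n) => x y xy [Bx Cx]; split.
    exact: cylinder_le (leq_maxl m n) cB _ _ xy Bx.
  exact: cylinder_le (leq_maxr m n) cC _ _ xy Cx.
- by move=> _; exists 0%N.
- by rewrite bigcup_const//; exists 0%N.
- move=> B [n cB]; rewrite (cylinder_shadows cB).
  rewrite !measure_fin_bigcup//; first last.
  + exact: mtrace.
  + exact: trivIset_shadow.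
  + exact: finite_trace.
  + exact: mtrace.
  + exact: trivIset_shadow.
  + exact: finite_trace.
  apply: eq_fsbigr => v; rewrite inE => /trace_coset nv.
  have vt : vertices c (n, v) := nv.
  exact: etrans (boundary_measure_shadow R vt) (esym (muS _ vt)).
- move=> _; rewrite [ltLHS](_ : _ = 1) ?ltry//; exact: boundary_measureT.
Qed.

End BoundaryMeasureUnique.

Section BoundaryAction.
Variables (G : groupType) (c : chain G).

Definition vertex_act (t : nat * set G) (g : G) : nat * set G :=
  (t.1, [set h * g | h in t.2]).

Lemma vertex_act1 t : vertex_act t 1 = t.
Proof.
case: t => n A; rewrite /vertex_act /=; congr pair.
by rewrite (_ : (fun h : G => h * 1) = id) ?image_id//; apply/funext => h; rewrite mulg1.
Qed.

Lemma vertex_actM t g h : vertex_act t (g * h) = vertex_act (vertex_act t g) h.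
Proof.
rewrite /vertex_act /= image_comp; congr pair.
by apply: eq_imagel => k _ /=; rewrite mulgA.
Qed.

Lemma vertex_act_vertices t g : vertices c t -> vertices c (vertex_act t g).
Proof.
case: t => n A [a _ /= <-]; exists (a * g) => //=.
by rewrite image_comp; apply: eq_imagel => k _ /=; rewrite mulgA.
Qed.

Lemma vertex_act_adjacent t u g : tree_adjacent t u -> tree_adjacent (vertex_act t g) (vertex_act u g).
Proof.
by case=> -[tu AB]; [left|right]; split=> //=; exact: image_subset.
Qed.

Definition ray_act (x : ray c) (g : G) : ray c.
Proof.
apply: (@Ray _ _ (fun k => vertex_act (x k) g)).
- rewrite ray_root /vertex_act /tree_root /=; congr pair.
  by apply/seteqP; split=> // h _; exists (h * g^-1) => //; rewrite mulgVK.
- by move=> k; apply: vertex_act_vertices; exact: ray_vertices.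
- by move=> k; apply: vertex_act_adjacent; exact: ray_adjacent.
- move=> j k /(congr1 (vertex_act^~ g^-1)).
  by rewrite -!vertex_actM mulgV !vertex_act1 => /ray_inj.
Defined.

Lemma ray_act1 x : ray_act x 1 = x.
Proof. by apply: ray_ext => k; exact: vertex_act1. Qed.

Lemma ray_actM x g h : ray_act x (g * h) = ray_act (ray_act x g) h.
Proof. by apply: ray_ext => k; exact: vertex_actM. Qed.

Definition stabilizer (x : ray c) : set G := [set g | ray_act x g = x].

Definition essentially_free (R : realType) : Prop :=
  {ae boundary_measure R (c := c), forall x, stabilizer x = [set 1]}.

End BoundaryAction.

(* Main.v *)
Require Import Defs.
From mathcomp Require Import all_boot all_order all_algebra finmap zify.
From mathcomp Require Import all_classical all_reals all_analysis.

(** A chain in the free group is the same as a tower of finite pointed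
transitive Schreier graphs: the subgroup is the stabilizer of the base point, its
right cosets are the vertices, and the proportion of rays that a group element
fixes down to level [n] is the proportion of vertices of the [n]-th graph that it
fixes.

The tower starts with one vertex, and each graph is a double cover of the
preceding one: two copies of it, with the two lifts of a single edge [e] swapped
between the copies.  This cover is connected, because going once around the cycle
of the generator that labels [e] leads from one copy to the other
([double_cycle], [transitive_double]).

- Trivial intersection.  If a reduced walk from the base point visits distinct
  vertices except perhaps at its last step, then its last edge is new
  ([last_edge_fresh]), and the cover along that edge makes all its vertices
  distinct ([uniq_visits_last]).  A schedule in which every word occurs
  infinitely often therefore makes, by induction on the length, the walk of every
  reduced word injective at some level ([uniq_visits_tower]).  A nontrivial
  element then moves the base point of that level.

- A generator [a] that fixes many rays.  Each fixed point of [a] has two lifts,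
  both fixed unless [e] is the loop of [a] at that point.  So the number [f n] of
  fixed points satisfies [f n.+1 >= 2 * f n - 2], and the proportion of fixed
  points loses at most [2 ^- n] at level [n].  These losses could add up to
  everything, but if the first two covers are taken along edges of another
  generator [b], which costs nothing, then [f 2 = 4] and the proportion stays at
  least one half ([card_fixed_tower]).  By continuity of the measure from above,
  the rays fixed by [a] have measure at least one half. *)

Set Implicit Arguments.
Unset Strict Implicit.
Unset Printing Implicit Defensive.

Import Order.TTheory GRing.Theory Num.Theory.
Local Open Scope classical_set_scope.

(** * Pointed Schreier graphs *)

(** Connectedness is the separate predicate [transitive_graph], so that a cover can
    be formed before it is known to be connected. *)
Record schreier (d : nat) := Schreier {
  point_of :> finType;
  act : letter d -> point_of -> point_of;
  actK : forall a, cancel (act a) (act (letter_inv a));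
  base : point_of }.

Section Walks.
Variables (d : nat) (S : schreier d).
Implicit Types (a : letter d) (u v w : seq (letter d)) (x y : S).

Definition walk x w : S := foldl (fun y a => act a y) x w.

(** The starting vertex is left out, so that prepending it gives all vertices of
    the walk in order. *)
Definition visits x w : seq S := scanl (fun y a => act a y) x w.

(** An edge is named by its generator and its tail, so that crossing it forwards
    or backwards gives the same name: see [edge_of_inv]. *)
Definition edge_of a x : 'I_d * S := (a.1, if a.2 then act a x else x).

Fixpoint edges x w : seq ('I_d * S) :=
  if w is a :: w' then edge_of a x :: edges (act a x) w' else [::].

Definition transitive_graph := forall x, exists w, walk (base S) w = x.

Lemma edge_of_inv a x : edge_of (letter_inv a) (act a x) = edge_of a x.
Proof. by rewrite /edge_of actK /=; case: a.2. Qed.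

Lemma walk_cat x u v : walk x (u ++ v) = walk (walk x u) v.
Proof. exact: foldl_cat. Qed.

Lemma mem_walk x w : walk x w \in x :: visits x w.
Proof.
elim: w x => [|a w IHw] x; first exact: mem_head.
by rewrite in_cons; apply/orP; right; exact: IHw.
Qed.

Lemma walk_foldr_push x u v : walk x (foldr (@push d) v u) = walk (walk x u) v.
Proof.
elim: u x => //= a u IHu x; rewrite -IHu.
case: (foldr _ _ u) => [|b w] //=; case: eqP => [->|//] /=.
by rewrite actK.
Qed.

Lemma walk_inv x w : walk (walk x w) (word_inv w) = x.
Proof.
elim: w x => //= a w IHw x.
by rewrite /word_inv /= rev_cons -cats1 walk_cat IHw /= actK.
Qed.

Lemma transitive_graph_free : transitive_graph ->
  forall x, exists g : free_group d, walk (base S) g = x.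
Proof.
move=> tS x; have [w <-] := tS x.
exists (FreeGroup (reduced_foldr w (isT : reduced [::]))) => /=.
by rewrite walk_foldr_push.
Qed.

(** An earlier crossing in the same direction would visit its starting vertex again
    just before the last step.  An earlier crossing in the opposite direction would
    arrive where the last step starts, hence be the step just before it, which
    reducedness forbids. *)
Lemma last_edge_fresh x u a : reduced (rcons u a) -> uniq (x :: visits x u) ->
  edge_of a (walk x u) \notin edges x u.
Proof.
elim: u x => //= b u IHu x rbu /andP[xNu uu].
rewrite inE negb_or {}IHu ?(reduced_behead rbu)// andbT.
apply/eqP; set z := walk _ u => eab.
(* The walk ends at [z] before its last letter; [z] is not the starting vertex. *)
have zx : z != x.
  apply: contraNneq xNu => zx.
  by rewrite -[X in X \in _]zx; exact: mem_walk.
have [ab1 ab2] : a.1 = b.1 /\ (if a.2 then act a z else z) = (if b.2 then act b x else x).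
  by case: eab.
(* Crossing in the same direction would give [z = x]. *)
have [ab|] := eqVneq a.2 b.2.
  have {}ab : a = b by rewrite [a]surjective_pairing ab1 ab -surjective_pairing.
  case/eqP: zx; move: ab2; rewrite ab; case: b.2 => //.
  exact: can_inj (actK b) _ _.
(* Crossing backwards starts from the head of the first edge, which the walk
   visits only once: it would have turned back at once. *)
move=> ab; have {}ab : a = letter_inv b.
  by rewrite [a]surjective_pairing ab1 /letter_inv; case: a.2 b.2 ab => [] [].
have zE : z = act b x.
  move: eab; rewrite ab -(edge_of_inv b x) => -[]; case: (~~ b.2) => //.
  exact: can_inj (actK (letter_inv b)) _ _.
case: u @z {eab ab2 zx} zE rbu xNu uu => [|c u] z zE; first by rewrite ab /= eqxx.
move=> _ _ /= /andP[/negP+ _]; apply; rewrite -[X in X \in _]zE.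
exact: (mem_walk (act c (act b x)) u).
Qed.

End Walks.

(** * Double covers twisted along one edge *)

Section DoubleCover.
Variables (d : nat) (S : schreier d) (e : 'I_d * S).
Implicit Types (a : letter d) (w : seq (letter d)) (x : S) (y : bool * S).

Definition double_act a y : bool * S :=
  (y.1 (+) (edge_of a y.2 == e), act a y.2).

Lemma double_actK a : cancel (double_act a) (double_act (letter_inv a)).
Proof.
by case=> b x; rewrite /double_act /= edge_of_inv actK -addbA addbb addbF.
Qed.

(** Two sheets over [S], exchanged when the edge [e] is crossed. *)
Definition double := @Schreier d (bool * S)%type double_act double_actK (false, base S).

Lemma walk_double_snd (y : double) w : (walk y w).2 = walk y.2 w.
Proof. by elim: w y => //= a w IHw y; rewrite IHw. Qed.

Lemma visits_double_snd (y : double) w : map snd (visits y w) = visits y.2 w.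
Proof. by elim: w y => //= a w IHw y; rewrite IHw. Qed.

Lemma uniq_visits_double w :
  uniq (base S :: visits (base S) w) -> uniq (base double :: visits (base double) w).
Proof. by move=> uS; apply: (@map_uniq _ _ snd); rewrite /= visits_double_snd. Qed.

(** The exchange of the two sheets commutes with the action. *)
Lemma walk_double_flip (b : bool) x w :
  walk ((~~ b, x) : double) w = (~~ (walk ((b, x) : double) w).1, walk x w).
Proof. by elim: w b x => //= a w IHw b x; rewrite /double_act /= addNb IHw. Qed.

Lemma visits_double_avoid (b : bool) x w : e \notin edges x w ->
  visits ((b, x) : double) w = map (pair b) (visits x w).
Proof.
elim: w x => //= a w IHw x; rewrite inE negb_or eq_sym => /andP[/negPf ea ew].
by rewrite /double_act /= ea addbF IHw.
Qed.

Lemma walk_double_avoid (b : bool) x w : e \notin edges x w ->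
  walk ((b, x) : double) w = (b, walk x w).
Proof.
elim: w x => //= a w IHw x; rewrite inE negb_or eq_sym => /andP[/negPf ea ew].
by rewrite /double_act /= ea addbF IHw.
Qed.

(** Turning once around the cycle of the generator that labels [e] crosses [e]
    exactly once. *)
Lemma double_cycle : exists w, forall b : bool,
  walk ((b, e.2) : double) w = (~~ b, e.2).
Proof.
pose a : letter d := (e.1, false); pose f : S -> S := act a.
have fI : injective f by apply: can_inj (actK a).
exists (nseq (order f e.2) a) => b.
have walkE j : (j <= order f e.2)%N ->
    walk ((b, e.2) : double) (nseq j a) = (b (+) (0 < j)%N, iter j f e.2).
  elim: j => [|j IHj] jo; first by rewrite addbF.
  have -> : nseq j.+1 a = nseq j a ++ [:: a] by rewrite -[j.+1]addn1 nseqD.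
  rewrite walk_cat (IHj (ltnW jo)) /= /double_act /=; congr (_, _).
  rewrite -addbA; congr (_ (+) _); case: j jo {IHj} => [|j] jo /=.
    by rewrite /edge_of /= -surjective_pairing eqxx.
  apply/negP => /eqP/(congr1 snd) /= jE.
  by have := findex_iter jo; rewrite /= jE findex0.
by rewrite walkE// iter_order// order_gt0 addbT.
Qed.

(** Walking to [e], around its cycle and back changes the sheet above the base
    point. *)
Lemma transitive_double : transitive_graph S -> transitive_graph double.
Proof.
move=> tS; have [v vE] : exists v, walk (base double) v = (true, base S).
  have [u uE] := tS e.2; have [c cE] := double_cycle.
  exists (u ++ c ++ word_inv u); rewrite !walk_cat.
  have := walk_inv (base double) u; have := walk_double_snd (base double) u.
  rewrite uE; case: (walk _ u) => b x /= -> ub.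
  by rewrite cE walk_double_flip ub /= -uE walk_inv.
case=> b x; have [w wE] := tS x.
case bE : ((walk (base double) w).1 == b).
  by exists w; rewrite [walk _ _]surjective_pairing (eqP bE) walk_double_snd wE.
exists (v ++ w); rewrite walk_cat vE (walk_double_flip false) wE; congr pair.
by move/negbT: bE; case: (_.1) b => [] [].
Qed.

End DoubleCover.

(** The cover along the last edge of a reduced walk separates its last vertex from
    the others: that edge is crossed only at the last step. *)
Lemma uniq_visits_last d (S : schreier d) u a :
  let D := double (edge_of a (walk (base S) u)) in
  reduced (rcons u a) -> uniq (base S :: visits (base S) u) ->
  uniq (base D :: visits (base D) (rcons u a)).
Proof.
move=> D rua uS; have eu := last_edge_fresh rua uS.
rewrite /visits scanl_rcons -/(visits _ _) -rcons_cons rcons_uniq uniq_visits_double// andbT.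
have -> : visits (base D) u = map (pair false) (visits (base S) u).
  exact: visits_double_avoid.
rewrite -/(walk _ _) -cats1 walk_cat /=.
have -> : walk (base D) u = (false, walk (base S) u) by exact: walk_double_avoid.
rewrite /double_act eqxx inE negb_or /=.
by apply/mapP => -[x _].
Qed.

Definition fixed_points d (S : schreier d) (a : letter d) : {pred S} :=
  [pred x | act a x == x].

Arguments fixed_points {d} S a.

(** Both points above a fixed point [x] are fixed, unless [e] is the loop at [x]. *)
Lemma card_fixed_double d (S : schreier d) (e : 'I_d * S) i :
  #|fixed_points (double e) (i, false)| =
  (#|[predI fixed_points S (i, false) & [pred x | (i, x) != e]]| * 2)%N.
Proof.
rewrite mulnC -card_bool -cardX; apply: eq_card => -[b x].
rewrite !inE /= /double_act xpair_eqE /= andbC.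
by congr andb; rewrite /edge_of /=; case: b (_ == e) => [] [].
Qed.

Lemma card_fixed_double_neq d (S : schreier d) (e : 'I_d * S) i : e.1 != i ->
  #|fixed_points (double e) (i, false)| = (#|fixed_points S (i, false)| * 2)%N.
Proof.
move=> ei; rewrite card_fixed_double; congr (_ * 2)%N; apply: eq_card => x.
rewrite !inE [X in _ && X](_ : _ = true) ?andbT//.
by apply: contraNneq ei => <-.
Qed.

Lemma card_fixed_double_ge d (S : schreier d) (e : 'I_d * S) i :
  ((#|fixed_points S (i, false)| - 1) * 2 <= #|fixed_points (double e) (i, false)|)%N.
Proof.
rewrite card_fixed_double leq_mul2r /=.
rewrite leq_subLR -(cardID [pred x | (i, x) == e] (fixed_points S _)); apply: leq_add.
  rewrite -(card1 e.2); apply: subset_leq_card; apply/fintype.subsetP => x.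
  by rewrite !inE => /andP[_ /eqP <-].
by apply: subset_leq_card; apply/fintype.subsetP => x; rewrite !inE andbC.
Qed.

(** * Cosets of the stabilizer of the base point *)

Section BaseStabilizer.
Local Open Scope group_scope.
Variables (d : nat) (S : schreier d).
Implicit Types (g h : free_group d) (x : S).

Definition base_stab : set (free_group d) := [set g | walk (base S) g = base S].

Definition base_fiber x : set (free_group d) := [set g | walk (base S) g = x].

Lemma walkM x g h : walk x (word (g * h)) = walk (walk x g) h.
Proof. exact: walk_foldr_push. Qed.

Lemma walkV x y g : walk x (word g) = y -> walk y (word g^-1) = x.
Proof. by move=> <-; exact: walk_inv. Qed.

Lemma base_stab_div g h : base_stab (g / h) <-> walk (base S) g = walk (base S) h.
Proof.
rewrite /base_stab /mkset walkM; split=> [/walkV|->]; last exact: walk_inv.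
by rewrite invgK => <-.
Qed.

Lemma base_stab_group : group_closed [in base_stab].
Proof.
split=> [|g h]; rewrite !inE// => gS hS.
by apply/base_stab_div; rewrite gS hS.
Qed.

Lemma right_coset_base_stab g : right_coset base_stab g = base_fiber (walk (base S) g).
Proof.
apply/seteqP; split=> [_ [h hS <-]|h hg]; first by rewrite /base_fiber /mkset walkM hS.
by exists (h / g); [exact/base_stab_div|exact: mulgVK].
Qed.

Hypothesis tS : transitive_graph S.

Lemma right_cosets_base_stab : right_cosets base_stab = range base_fiber.
Proof.
apply/seteqP; split=> A [].
  by move=> g _ <-; rewrite right_coset_base_stab; eexists.
move=> x _ <-; have [g <-] := transitive_graph_free tS x.
by exists g; rewrite ?right_coset_base_stab.
Qed.

Lemma base_fiber_inj : injective base_fiber.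
Proof.
move=> x y xy; have [g gx] := transitive_graph_free tS x.
by have : base_fiber x g by []; rewrite xy /base_fiber /= gx.
Qed.

Lemma card_base_fiber (P : {pred S}) :
  #|` fset_set (base_fiber @` [set` P])| = #|P|.
Proof.
rewrite fset_set_image; last exact: finite_finset.
rewrite card_imfset /=; last exact: base_fiber_inj.
rewrite -card_finset; congr #|` _|; apply/fsetP => x.
by rewrite in_fset_set ?mem_setE ?inE; [|exact: finite_finset].
Qed.

Lemma finite_right_cosets_base_stab : finite_set (right_cosets base_stab).
Proof.
by rewrite right_cosets_base_stab; apply: finite_image; exact: finite_finset.
Qed.

Lemma subgroup_index_base_stab : subgroup_index base_stab = #|S|.
Proof.
rewrite /subgroup_index right_cosets_base_stab -(card_base_fiber predT).
by congr #|` fset_set (base_fiber @` _)|; apply/seteqP; split.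
Qed.

(** The action on the cosets is the action on the vertices. *)
Lemma base_fiber_act x i :
  [set h * free_gen i | h in base_fiber x] = base_fiber (act (i, false) x).
Proof.
apply/seteqP; split=> [_ [h hx <-]|h hx].
  by rewrite /base_fiber /mkset walkM hx.
exists (h / free_gen i); last exact: mulgVK.
by rewrite /base_fiber /mkset walkM hx /= actK.
Qed.

End BaseStabilizer.

(** * A tower of double covers *)

Section Tower.
Variables (d : nat) (a b : 'I_d).
Hypothesis ba : b != a.

(** The word [rcons u l] whose last edge gives the cover of the [n]-th graph, as
    the pair [(u, l)].  The first component of the decoded pair is a dummy that
    makes every word occur infinitely often; the first two covers are along an
    edge of [b]. *)
Definition schedule n : seq (letter d) * letter d :=
  let t0 := ([::], (b, false)) in
  if (n < 2)%N then t0
  else oapp snd t0 (choice.unpickle n : option (nat * (seq (letter d) * letter d))).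

Definition one_point : schreier d :=
  @Schreier d unit (fun _ => id) (fun _ _ => erefl) tt.

Definition next_edge n (S : schreier d) : 'I_d * S :=
  edge_of (schedule n).2 (walk (base S) (schedule n).1).

Fixpoint tower n : schreier d :=
  if n is m.+1 then double (next_edge m (tower m)) else one_point.

Lemma schedule_often t N : exists2 n, (N <= n)%N & schedule n = t.
Proof.
pose M := maxn N 2; have [k kM] : exists k : nat, (M <= choice.pickle (k, t))%N.
  apply: contrapT => small; pose f (k : nat) := choice.pickle (k, t).
  have fI : injective f by move=> j k /(pcan_inj choice.pickleK)[].
  suff : (size (map f (iota 0 M.+1)) <= size (iota 0 M))%N.
    by rewrite size_map !size_iota ltnn.
  apply: uniq_leq_size => [|_ /mapP[k _ ->]]; first by rewrite map_inj_uniq ?iota_uniq.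
  by rewrite mem_iota /= add0n ltnNge; apply/negP => kM; apply: small; exists k.
exists (choice.pickle (k, t)); first by apply: leq_trans kM; exact: leq_maxl.
rewrite /schedule ltnNge (leq_trans _ kM) ?leq_maxr//=.
by rewrite choice.pickleK.
Qed.

Lemma transitive_tower n : transitive_graph (tower n).
Proof.
elim: n => [|n IHn]; last exact: transitive_double.
by case; exists [::].
Qed.

Lemma card_tower n : #|tower n| = (2 ^ n)%N.
Proof.
elim: n => [|n IHn]; first exact: card_unit.
by rewrite expnS -IHn -card_bool -card_prod.
Qed.

(** The number [f n] of fixed points satisfies [f n.+1 >= 2 * f n - 2], and from
    [f 2 = 4] on this preserves the slightly stronger bound
    [f n.+2 >= 2 ^ n.+1 + 2]. *)
Lemma card_fixed_tower n : (2 ^ n <= #|fixed_points (tower n) (a, false)| * 2)%N.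
Proof.
pose f n := #|fixed_points (tower n) (a, false)|.
have f0 : f 0 = 1 by rewrite -[RHS]card_unit; apply: eq_card => -[].
have f1 : f 1 = 2.
  have := @card_fixed_double_neq _ (tower 0) (next_edge 0 (tower 0)) a ba.
  by rewrite -/(f 0) -/(f 1) f0.
have f2 : f 2 = 4.
  have := @card_fixed_double_neq _ (tower 1) (next_edge 1 (tower 1)) a ba.
  by rewrite -/(f 1) -/(f 2) f1.
case: n => [|[|n]]; rewrite -/(f _) ?f0 ?f1//.
suff : (2 ^ n.+1 + 2 <= f n.+2)%N by rewrite (expnS 2 n.+1); lia.
elim: n => [|n IHn]; first by rewrite f2.
have := @card_fixed_double_ge _ (tower n.+2) (next_edge n.+2 (tower n.+2)) a.
by rewrite -/(f n.+2) -/(f n.+3) (expnS 2 n.+1); lia.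
Qed.

Lemma uniq_visits_tower_le m n w : (m <= n)%N ->
  uniq (base (tower m) :: visits (base (tower m)) w) ->
  uniq (base (tower n) :: visits (base (tower n)) w).
Proof.
by move=> /subnK <- um; elim: (n - m)%N => // k IHk; exact: uniq_visits_double.
Qed.

(** By induction on the length: once the walk without its last letter is
    injective, a later stage of the schedule separates the last vertex from the
    others. *)
Lemma uniq_visits_tower w : reduced w ->
  exists n, uniq (base (tower n) :: visits (base (tower n)) w).
Proof.
elim/last_ind: w => [|u l IHu] rul; first by exists 0.
have [N uN] : exists n, uniq (base (tower n) :: visits (base (tower n)) u).
  by apply: IHu; move: rul; rewrite /reduced -cats1 => /cat_sorted2[].
have [n Nn tn] := schedule_often (u, l) N; exists n.+1.
have := uniq_visits_last rul (uniq_visits_tower_le Nn uN).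
by rewrite /= /next_edge tn.
Qed.

Lemma base_stab_tower0 : base_stab (tower 0) = setT.
Proof. by apply/seteqP; split=> // g _; exact: (unitE (@walk d (tower 0) tt g)). Qed.

Lemma base_stab_tower_S n : base_stab (tower n.+1) `<=` base_stab (tower n).
Proof.
move=> g; rewrite /base_stab /mkset => /(congr1 snd).
by rewrite [LHS]walk_double_snd.
Qed.

Definition tower_chain : chain (free_group d) :=
  @Chain _ (fun n => base_stab (tower n))
    (fun n => base_stab_group (tower n))
    (fun n => finite_right_cosets_base_stab (@transitive_tower n))
    base_stab_tower0 base_stab_tower_S.

(** An injective walk of positive length does not end where it starts. *)
Lemma bigcap_tower_chain : \bigcap_n tower_chain n = [set 1%g].
Proof.
apply/seteqP; split=> [g gn|_ -> n _]; last by [].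
have [n] := uniq_visits_tower (word_reduced g).
have : base_stab (tower n) g by exact: gn.
rewrite /base_stab /=; case gw: (word g) => [|l w]; first by move=> _ _; exact: val_inj.
move=> gE /andP[/negP+ _]; case; rewrite -[X in X \in _]gE.
exact: (mem_walk (act l (base (tower n))) w).
Qed.

End Tower.

(** * Rays fixed by a group element *)

Section FixedRays.
Variables (R : realType) (G : groupType) (c : chain G) (g : G).

Definition fixed_to_level n : set (ray c) :=
  [set x | (ray_act x g n).2 = (x n).2].

Lemma cylinder_fixed_to_level n : cylinder n (fixed_to_level n).
Proof. by move=> x y xy; rewrite /fixed_to_level /= xy. Qed.

Lemma measurable_cylinder n (A : set (ray c)) :
  cylinder n A -> measurable (A : set (boundary c)).
Proof.
move=> /cylinder_shadows ->; apply: fin_bigcup_measurable; first exact: finite_trace.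
by move=> v /trace_coset nv; exact: measurable_shadow.
Qed.

Lemma bigcap_fixed_to_level : \bigcap_n fixed_to_level n = [set x | stabilizer x g].
Proof.
apply/seteqP; split=> x xg; last by move=> n _; rewrite /fixed_to_level /mkset xg.
by apply: ray_ext => n; apply: ray_agree (leqnn n) _; exact: xg.
Qed.

(** The rays fixed by [g] are the decreasing intersection of the sets
    [fixed_to_level n], so a uniform lower bound on the measures of these sets
    passes to the limit. *)
Lemma not_essentially_free (e : R) : g != 1%g -> (0 < e)%R ->
  (forall n, e%:E <= boundary_measure R (fixed_to_level n))%E ->
  ~ essentially_free c R.
Proof.
move=> g1 e0 Fe [N [mN N0 sN]].
have mF n : measurable (fixed_to_level n : set (boundary c)).
  exact: measurable_cylinder (@cylinder_fixed_to_level n).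
have mcapF : measurable (\bigcap_n fixed_to_level n : set (boundary c)).
  exact: bigcapT_measurable.
have : (e%:E <= boundary_measure R (\bigcap_n fixed_to_level n))%E.
  apply: (cvge_ge _ (nonincreasing_cvg_mu (mu := boundary_measure R (c := c)) _ mF mcapF _)).
  - by apply: nearW => n; exact: Fe.
  - by apply: le_lt_trans (probability_le1 _ (mF 0)) _; rewrite ltry.
  - move=> m n mn; apply/subsetPset => x xn; rewrite /fixed_to_level /=.
    by have /(congr1 snd) := @ray_agree _ _ (ray_act x g) x _ _ mn xn.
apply/negP; rewrite -ltNge (le_lt_trans _ (_ : 0%E < _)%E) ?lte_fin// -N0.
apply: le_measure; rewrite ?inE// bigcap_fixed_to_level => x /= xg.
apply: sN => /= /seteqP[+ _] => /(_ _ xg) /= gE.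
by rewrite gE eqxx in g1.
Qed.

End FixedRays.

Lemma trace_fixed_tower d (a b : 'I_d) n :
  trace n (@fixed_to_level _ (tower_chain b) (free_gen a) n) =
  (@base_fiber d (tower b n)) @` [set` fixed_points (tower b n) (a, false)].
Proof.
have tS := @transitive_tower d b n.
apply/seteqP; split=> [_ [x xa <-]|_ [t ta <-]].
  have : right_cosets (base_stab (tower b n)) (x n).2 by exact: (@ray_coset _ (tower_chain b) x n).
  rewrite (right_cosets_base_stab tS) => -[t _ tx]; exists t => //.
  move: xa; rewrite /fixed_to_level /= -tx base_fiber_act => /(base_fiber_inj tS) ta.
  by rewrite /= inE ta.
have [x xt] : exists x : ray (tower_chain b), (x n).2 = base_fiber t.
  apply: (@right_cosets_ray _ (tower_chain b) n); rewrite /= (right_cosets_base_stab tS).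
  by exists t.
exists x => //; rewrite /fixed_to_level /= xt base_fiber_act.
by congr base_fiber; exact/eqP.
Qed.

Theorem theorem1 (R : realType) (d : nat) (hd : (2 <= d)%N) :
  exists c : chain (free_group d),
    \bigcap_n c n = [set 1%g] /\ ~ essentially_free c R.
Proof.
pose a : 'I_d := Ordinal (ltnW hd); pose b : 'I_d := Ordinal hd.
exists (tower_chain b); split; first exact: bigcap_tower_chain.
apply: (@not_essentially_free R _ _ (free_gen a) 2^-1) => // n.
rewrite (boundary_measureE _ (@cylinder_fixed_to_level _ _ (free_gen a) n)) lee_fin.
have tS := @transitive_tower d b n.
rewrite trace_fixed_tower (card_base_fiber tS) (subgroup_index_base_stab tS) card_tower.
rewrite ler_pdivlMr ?ltr0n ?expn_gt0// mulrC ler_pdivrMr ?ltr0n//.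
by rewrite -natrM ler_nat; exact: card_fixed_tower.
Qed.
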